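(* Let $(S,\circ)$ be a semigroup and let $(L,R)$ be a bitranslation of $S$ satisfying $L^2=R^2=\mathrm{id}$, $LR=RL$, and $L\neq R$. Then the structure $(M,\ast)$, where $M=S\cup\{a,e\}$ for some distinct $a,e\notin S$, with $e$ neutral for $\ast$, and $$x\ast y=\begin{cases} x\circ y, & \text{if } x,y\in S,\\ L(y), & \text{if } x=a \text{ and } y\in S,\\ R(x), & \text{if } x\in S \text{ and } y=a,\\ e, & \text{if } x=a \text{ and } y=a,\end{cases}$$ is a W-monoid. Moreover, all W-monoids can be constructed in this manner.
   Context: For a semigroup $(S,\circ)$: a left translation of $S$ is a map $\lambda\colon S\to S$ with $\lambda(x\circ y)=\lambda(x)\circ y$ for all $x,y\in S$; a right translation of $S$ is a map $\rho\colon S\to S$ with $\rho(x\circ y)=x\circ\rho(y)$ for all $x,y\in S$; a bitranslation of $S$ is a pair $(\lambda,\rho)$ where $\lambda$ is a left translation, $\rho$ is a right translation, and $x\circ\lambda(y)=\rho(x)\circ y$ for all $x,y\in S$. Here $L^2$, $R^2$, $LR$, $RL$ denote compositions of maps $S\to S$, and $\mathrm{id}$ is the identity map of $S$. A W-monoid is a semigroup $(M,\ast)$ with a neutral element $e$ for which there exists an element $a\in M$ such that: (W1) for any $x,y\in M$, $x\ast y=e$ if and only if ($x=a$ and $y=a$) or ($x=e$ and $y=e$); (W2) for any $x,y\in M$, $x\ast y=a$ if and only if ($x=a$ and $y=e$) or ($x=e$ and $y=a$); (W3) $a$ is noncentral for $\ast$, i.e. there is $x\in M$ with $a\ast x\neq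 x\ast a$. *)

(* Defs.v *)
From mathcomp Require Import ssreflect ssrfun ssrbool.

Set Implicit Arguments.
Unset Strict Implicit.
Unset Printing Implicit Defensive.

(* Semigroups are given as a bare type with an [associative] operation: the
   [semigroupType] of mathcomp would also impose a [choiceType] structure on
   the carrier. *)

Definition left_translation (S : Type) (op : S -> S -> S) (l : S -> S) : Prop :=
  forall x y, l (op x y) = op (l x) y.

Definition right_translation (S : Type) (op : S -> S -> S) (r : S -> S) : Prop :=
  forall x y, r (op x y) = op x (r y).

Definition bitranslation (S : Type) (op : S -> S -> S) (l r : S -> S) : Prop :=
  [/\ left_translation op l, right_translation op r
    & forall x y, op x (l y) = op (r x) y].

Definition W_monoid (M : Type) (mul : M -> M -> M) (e : M) : Prop :=
  [/\ associative mul, left_id e mul, right_id e mul &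
   exists a : M,
     [/\ forall x y, mul x y = e <-> (x = a /\ y = a) \/ (x = e /\ y = e),
         forall x y, mul x y = a <-> (x = a /\ y = e) \/ (x = e /\ y = a)
       & exists x, mul a x <> mul x a]].

(* M is the disjoint union of the image of S under [iota] and of two distinct
   points a and e. *)
Definition two_point_extension (S M : Type) (iota : S -> M) (a e : M) : Prop :=
  [/\ injective iota, a <> e, forall x, iota x <> a, forall x, iota x <> e
    & forall m, [\/ exists x, m = iota x, m = a | m = e]].

(* The last four fields are the four cases of the product displayed in the
   definition of the construction, with S viewed inside M through [iota];
   together with neutrality of e they determine [mul]. *)
Record W_construction (S : Type) (op : S -> S -> S) (L R : S -> S)
    (M : Type) (mul : M -> M -> M) (iota : S -> M) (a e : M) : Prop := {
  W_construction_carrier : two_point_extension iota a e;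
  W_construction_mul1m : left_id e mul;
  W_construction_mulm1 : right_id e mul;
  W_construction_SS : forall x y, mul (iota x) (iota y) = iota (op x y);
  W_construction_aS : forall y, mul a (iota y) = iota (L y);
  W_construction_Sa : forall x, mul (iota x) a = iota (R x);
  W_construction_aa : mul a a = e
}.

(* The construction can always be carried out, so a statement quantified over
   all instances of [W_construction] is not vacuous. *)
Lemma W_construction_exists (S : Type) (op : S -> S -> S) (L R : S -> S) :
  exists (M : Type) (mul : M -> M -> M) (iota : S -> M) (a e : M),
    W_construction op L R mul iota a e.
Proof.
pose mul (u v : option (option S)) : option (option S) :=
  match u, v with
  | None, _ => v
  | _, None => u
  | Some None, Some None => None
  | Some None, Some (Some y) => Some (Some (L y))
  | Some (Some x), Some None => Some (Some (R x))
  | Some (Some x), Some (Some y) => Some (Some (op x y))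
  end.
exists (option (option S)), mul, (fun x => Some (Some x)), (Some None), None.
split=> //; last by case=> [[x|]|].
split=> //; first by move=> x y [].
by case=> [[x|]|]; [constructor 1; exists x | constructor 2 | constructor 3].
Qed.

(* Main.v *)
Require Import Defs.
From mathcomp Require Import ssreflect ssrfun ssrbool.
From Stdlib Require Import Classical.

(** The construction adjoins to [S] an identity [e] and an involution [a] that
    acts on [S] from the left as [L] and from the right as [R].  Read this way,
    each identity required of [L] and [R] is one instance of associativity in
    which [a] occurs, and [L] differs from [R] exactly when [a] fails to commute
    with some element of [S].  As [S] is stable under products with every element of the
    monoid, [e] and [a] arise only as products inside the two-element group
    formed by [a] and [e]; this is the content of (W1) and (W2).

    Conversely, in a W-monoid, (W1) and (W2) say that a product with a factor
    outside [{a, e}] is again outside [{a, e}].  The complement [S] of [{a, e}] is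
    therefore a subsemigroup stable under the translations [a * _] and [_ * a];
    these are the required [L] and [R], and their properties are associativity
    together with [a * a = e].  A witness of noncentrality of [a] is neither [a]
    nor [e], so it lies in [S] and separates [L] from [R]. *)

(** Apart from associativity in [S], the cases in which no factor is [e] are
    [aaS] and [Saa] (the two involutions), [aSa] ([LR = RL]), [aSS] and [SSa]
    (left and right translation), [SaS] (the linking identity) and [aaa]. *)
Lemma W_construction_associative (S : Type) (op : S -> S -> S) (L R : S -> S)
    (M : Type) (mul : M -> M -> M) (iota : S -> M) (a e : M) :
  associative op -> bitranslation op L R ->
  L \o L =1 id -> R \o R =1 id -> L \o R =1 R \o L ->
  W_construction op L R mul iota a e -> associative mul.
Proof.
move=> opA [lL rR lrLR] LL RR LR [[_ _ _ _ cover] mul1m mulm1 SS aS Sa aa] x y z.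
case: (cover x) => [[x' ->]|->|->]; last by rewrite !mul1m.
  case: (cover y) => [[y' ->]|->|->]; last by rewrite mul1m mulm1.
    case: (cover z) => [[z' ->]|->|->]; last by rewrite !mulm1.
      by rewrite !SS opA.
    by rewrite SS !Sa SS rR.
  case: (cover z) => [[z' ->]|->|->]; last by rewrite !mulm1.
    by rewrite aS Sa !SS lrLR.
  by rewrite aa mulm1 !Sa [R (R x')]RR.
case: (cover y) => [[y' ->]|->|->]; last by rewrite mul1m mulm1.
  case: (cover z) => [[z' ->]|->|->]; last by rewrite !mulm1.
    by rewrite SS !aS SS lL.
  by rewrite Sa !aS Sa [L (R y')]LR.
case: (cover z) => [[z' ->]|->|->]; last by rewrite !mulm1.
  by rewrite aa mul1m !aS [L (L z')]LL.
by rewrite aa mul1m mulm1.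
Qed.

Lemma W_construction_W_monoid (S : Type) (op : S -> S -> S) (L R : S -> S)
    (M : Type) (mul : M -> M -> M) (iota : S -> M) (a e : M) :
  associative op -> bitranslation op L R ->
  L \o L =1 id -> R \o R =1 id -> L \o R =1 R \o L -> ~ (L =1 R) ->
  W_construction op L R mul iota a e -> W_monoid mul e.
Proof.
move=> opA bLR LL RR LR neqLR W.
have mulA : associative mul by apply: W_construction_associative W.
case: W => [[iota_inj neq_ae iota_a iota_e cover] mul1m mulm1 SS aS Sa aa].
split=> //; exists a; split.
- move=> x y; split; last by case=> [[-> ->]|[-> ->]].
  case: (cover x) => [[x' ->]|->|->]; last by rewrite mul1m; right.
    case: (cover y) => [[y' ->]|->|->].
    + by rewrite SS => /iota_e.
    + by rewrite Sa => /iota_e.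
    + by rewrite mulm1 => /iota_e.
  case: (cover y) => [[y' ->]|->|->]; [|by left|].
    by rewrite aS => /iota_e.
  by rewrite mulm1 => /neq_ae.
- move=> x y; split; last by case=> [[-> ->]|[-> ->]].
  case: (cover x) => [[x' ->]|->|->]; last by rewrite mul1m; right.
    case: (cover y) => [[y' ->]|->|->].
    + by rewrite SS => /iota_a.
    + by rewrite Sa => /iota_a.
    + by rewrite mulm1 => /iota_a.
  case: (cover y) => [[y' ->]|->|->]; last by left.
    by rewrite aS => /iota_a.
  by rewrite aa => /esym /neq_ae.
- have [x neq_x] := not_all_ex_not _ _ neqLR.
  by exists (iota x); rewrite aS Sa => /iota_inj.
Qed.

Lemma W_monoid_W_construction (M : Type) (mul : M -> M -> M) (e : M) :
  W_monoid mul e ->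
  exists (S : Type) (op : S -> S -> S) (L R : S -> S) (iota : S -> M) (a : M),
    associative op /\
    bitranslation op L R /\
    L \o L =1 id /\ R \o R =1 id /\ L \o R =1 R \o L /\ ~ (L =1 R) /\
    W_construction op L R mul iota a e.
Proof.
case=> mulA mul1m mulm1 [a [W1 W2 [x0 neq_x0]]].
have neq_ae : a <> e by move=> eq_ae; case: neq_x0; rewrite eq_ae mul1m mulm1.
have aa : mul a a = e by apply/W1; left.
pose outside m := m <> a /\ m <> e.
have out_mull x y : outside x -> outside (mul x y).
  by move=> [xa xe]; split=> [/W2|/W1] [[]|[]].
have out_mulr x y : outside y -> outside (mul x y).
  by move=> [ya ye]; split=> [/W2|/W1] [[_]|[_]].
pose S := {m | outside m}; pose iota : S -> M := @proj1_sig M outside.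
have iota_inj : injective iota.
  move=> [x px] [y py] /= eq_xy; case: y / eq_xy py => py.
  by rewrite (proof_irrelevance _ px py).
pose op (x y : S) : S := exist _ _ (out_mull _ (iota y) (proj2_sig x)).
pose L (y : S) : S := exist _ _ (out_mulr a _ (proj2_sig y)).
pose R (x : S) : S := exist _ _ (out_mull _ a (proj2_sig x)).
exists S, op, L, R, iota, a; split; [|split; [|split; [|split; [|split]]]].
- by move=> x y z; apply: iota_inj; apply: mulA.
- split=> x y; apply: iota_inj; rewrite /= ?mulA //.
- by move=> x; apply: iota_inj; rewrite /= mulA aa mul1m.
- by move=> x; apply: iota_inj; rewrite /= -mulA aa mulm1.
- by move=> x; apply: iota_inj; rewrite /= mulA.
split=> [eqLR|].
  have out_x0 : outside x0.
    by split=> eq_x0; apply: neq_x0; rewrite eq_x0 ?mul1m ?mulm1.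
  by apply: neq_x0; exact: (congr1 iota (eqLR (exist _ x0 out_x0))).
split=> //; split=> //.
- by move=> [x []].
- by move=> [x []].
move=> m; have [->|ma] := classic (m = a); first by constructor 2.
have [->|me] := classic (m = e); first by constructor 3.
by constructor 1; exists (exist _ m (conj ma me)).
Qed.

Theorem theorem4p5 :
  (forall (S : Type) (op : S -> S -> S) (L R : S -> S),
     associative op ->
     bitranslation op L R ->
     L \o L =1 id -> R \o R =1 id -> L \o R =1 R \o L -> ~ (L =1 R) ->
     forall (M : Type) (mul : M -> M -> M) (iota : S -> M) (a e : M),
       W_construction op L R mul iota a e -> W_monoid mul e)
  /\
  (forall (M : Type) (mul : M -> M -> M) (e : M),
     W_monoid mul e ->
     exists (S : Type) (op : S -> S -> S) (L R : S -> S) (iota : S -> M) (a : M),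
       associative op /\
       bitranslation op L R /\
       L \o L =1 id /\ R \o R =1 id /\ L \o R =1 R \o L /\ ~ (L =1 R) /\
       W_construction op L R mul iota a e).
Proof.
split; last exact: W_monoid_W_construction.
move=> S op L R opA bLR LL RR LR neqLR M mul iota a e.
exact: W_construction_W_monoid.
Qed.
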